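(* Let $(\phi_{i,j}^{n})$, $0\le n\le N$, be a solution of the fully discrete upwind Lagrange multiplier scheme (S1)--(S9) described in the context. Then the scheme is energy stable and satisfies the following discrete energy dissipation law for every $n\in\{0,\dots,N-1\}$: $$\frac{\mathcal{W}^{n+1}-\mathcal{W}^{n}}{\Delta t}\le -\Delta x\Delta y\sum_{i=1}^{N_x-1}\sum_{j=1}^{N_y}\min\left\{M(\phi_{i,j}^{n+1},\phi_{i+1,j}^{n+1}),M(\phi_{i+1,j}^{n+1},\phi_{i,j}^{n+1})\right\}\left|V_{i+\frac12,j}^{n+1}\right|^2$$ $$\qquad-\Delta x\Delta y\sum_{i=1}^{N_x}\sum_{j=1}^{N_y-1}\min\left\{M(\phi_{i,j}^{n+1},\phi_{i,j+1}^{n+1}),M(\phi_{i,j+1}^{n+1},\phi_{i,j}^{n+1})\right\}\left|V_{i,j+\frac12}^{n+1}\right|^2\le 0,$$ where $$\mathcal{W}^{n}=\Delta x\Delta y\sum_{i=1}^{N_x-1}\sum_{j=1}^{N_y}\frac{\varepsilon^2}{2}\left(\frac{\phi_{i+1,j}^{n}-\phi_{i,j}^{n}}{\Delta x}\right)^2+\Delta x\Delta y\sum_{i=1}^{N_x}\sum_{j=1}^{N_y-1}\frac{\varepsilon^2}{2}\left(\frac{\phi_{i,j+1}^{n}-\phi_{i,j}^{n}}{\Delta y}\right)^2+\Delta x\Delta y\sum_{i=1}^{N_x}\sum_{j=1}^{N_y}F(\phi_{i,j}^{n})+\Delta x\sum_{i=1}^{N_x}g(\phi_{i,1}^{n}).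$$
   Context: Parameters: real numbers $\varepsilon>0$, $\kappa>0$, $\Delta t>0$, $\Delta x>0$, $\Delta y>0$, $\theta_s\in[0,\pi]$, and positive integers $N_x,N_y,N$. Cells are indexed by $i=1,\dots,N_x$, $j=1,\dots,N_y$; the row $j=1$ is adjacent to the substrate $\Gamma_w$. Potential: $F$ is one of the following. (Logarithmic Flory--Huggins) For a fixed $\theta\in(0,1)$ let $F_{log}(\chi)=\frac{\theta}{2}[(1+\chi)\ln(1+\chi)+(1-\chi)\ln(1-\chi)]+\frac12(1-\chi^2)$, let $\beta\in(0,1)$ be the positive root of $\frac{\theta}{2}\ln\frac{1+\chi}{1-\chi}-\chi=0$, and $F(\chi)=F_{log}(\chi)-F_{log}(\beta)$; (Polynomial) $F(\chi)=\frac14(1-\chi^2)^2$, with $\beta=1$. In the logarithmic case, $F$ and $F'$ are given by their formulas on $(-1,1)$, and at points $\chi$ with $|\chi|\ge1$ the symbols $F(\chi)$, $F'(\chi)$ denote arbitrary fixed real numbers. Put $c_F=\int_{-\beta}^{\beta}\sqrt{2F(\chi)}\,d\chi$ and $g(\chi)=\frac{\varepsilon c_F\cos\theta_s}{4\beta^3}(\chi^3-3\beta^2\chi)$. Notation: $\chi^+=\max\{\chi,0\}$, $\chi^-=\min\{\chi,0\}$, and the two-state upwind mobility is $M(\chi_1,\chi_2)=(1+\chi_1)^+(1-\chi_2)^+$. Scheme: a solution consists of real numbers $\phi_{i,j}^n$ ($0\le n\le N$) and, for each $n=0,\dots,N-1$, real numbers $\mu_{i,j}^{n+1}$, fluxes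 $J^{n+1}$, velocities $V^{n+1}$, scalars $\xi^{n+1},\eta^{n+1}$ (independent of $i,j$) and ghost values such that: (S1) $\phi_{i,j}^{n+1}-\phi_{i,j}^{n}=-\frac{\Delta t}{\Delta x}(J_{i+\frac12,j}^{n+1}-J_{i-\frac12,j}^{n+1})-\frac{\Delta t}{\Delta y}(J_{i,j+\frac12}^{n+1}-J_{i,j-\frac12}^{n+1})$ for all cells. (S2) At interior faces ($1\le i\le N_x-1$, $1\le j\le N_y$): $J_{i+\frac12,j}^{n+1}=(V_{i+\frac12,j}^{n+1})^+M(\phi_{i,j}^{n+1},\phi_{i+1,j}^{n+1})+(V_{i+\frac12,j}^{n+1})^-M(\phi_{i+1,j}^{n+1},\phi_{i,j}^{n+1})$, with $V_{i+\frac12,j}^{n+1}=-\frac{1}{\Delta x}(\mu_{i+1,j}^{n+1}-\mu_{i,j}^{n+1})$. (S3) At interior faces ($1\le i\le N_x$, $1\le j\le N_y-1$): $J_{i,j+\frac12}^{n+1}=(V_{i,j+\frac12}^{n+1})^+M(\phi_{i,j}^{n+1},\phi_{i,j+1}^{n+1})+(V_{i,j+\frac12}^{n+1})^-M(\phi_{i,j+1}^{n+1},\phi_{i,j}^{n+1})$, with $V_{i,j+\frac12}^{n+1}=-\frac{1}{\Delta y}(\mu_{i,j+1}^{n+1}-\mu_{i,j}^{n+1})$. (S4) No flux: $J_{\frac12,j}^{n+1}=J_{N_x+\frac12,j}^{n+1}=0$ and $J_{i,\frac12}^{n+1}=J_{i,N_y+\frac12}^{n+1}=0$. (S5) $\mu_{i,j}^{n+1}=-\varepsilon^2(\Delta\phi)_{i,j}^{n+1}+\xi^{n+1}F'(\phi_{i,j}^{n+1})$.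 (S6) $(\Delta\phi)_{i,j}^{n+1}=\frac{\phi_{i+1,j}^{n+1}-2\phi_{i,j}^{n+1}+\phi_{i-1,j}^{n+1}}{\Delta x^2}+\frac{\phi_{i,j+1}^{n+1}-2\phi_{i,j}^{n+1}+\phi_{i,j-1}^{n+1}}{\Delta y^2}$. (S7) Ghost values (encoding the homogeneous Neumann condition on the non-substrate boundary and the dynamic contact line condition $\phi_{i,1}^{n+1}-\phi_{i,1}^{n}=-\kappa\Delta t\,(-\varepsilon^2\frac{\phi_{i,1}^{n+1}-\phi_{i,0}^{n+1}}{\Delta y}+\eta^{n+1}g'(\phi_{i,1}^{n+1}))$ on the substrate): $\phi_{0,j}^{n+1}=\phi_{1,j}^{n+1}$, $\phi_{N_x+1,j}^{n+1}=\phi_{N_x,j}^{n+1}$, $\phi_{i,N_y+1}^{n+1}=\phi_{i,N_y}^{n+1}$, and $\phi_{i,0}^{n+1}=\left(1-\frac{\Delta y}{\varepsilon^2\kappa\Delta t}\right)\phi_{i,1}^{n+1}+\frac{\Delta y}{\varepsilon^2\kappa\Delta t}\phi_{i,1}^{n}-\frac{\Delta y}{\varepsilon^2}\eta^{n+1}g'(\phi_{i,1}^{n+1})$. (S8) $\sum_{i=1}^{N_x}\sum_{j=1}^{N_y}(F(\phi_{i,j}^{n+1})-F(\phi_{i,j}^{n}))=\xi^{n+1}\sum_{i=1}^{N_x}\sum_{j=1}^{N_y}F'(\phi_{i,j}^{n+1})(\phi_{i,j}^{n+1}-\phi_{i,j}^{n})$. (S9) $\sum_{i=1}^{N_x}(g(\phi_{i,1}^{n+1})-g(\phi_{i,1}^{n}))=\eta^{n+1}\sum_{i=1}^{N_x}g'(\phi_{i,1}^{n+1})(\phi_{i,1}^{n+1}-\phi_{i,1}^{n})$.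 *)

(* Defs.v *)
From Stdlib Require Import Reals Lra Lia.
From Coquelicot Require Import Coquelicot.
Open Scope R_scope.

Definition F_log (theta x : R) : R :=
  theta / 2 * ((1 + x) * ln (1 + x) + (1 - x) * ln (1 - x)) + (1 - x ^ 2) / 2.

Definition F_pol (x : R) : R := (1 - x ^ 2) ^ 2 / 4.

(** In [FloryHuggins theta beta F_out dF_out] the functions [F_out] and [dF_out]
    supply the arbitrary values of [F] and [F'] at points [x] with [1 <= |x|],
    where the logarithmic formulas are meaningless. *)
Inductive potential : Type :=
| FloryHuggins (theta beta : R) (F_out dF_out : R -> R)
| Polynomial.

Definition potential_wf (P : potential) : Prop :=
  match P with
  | FloryHuggins theta beta _ _ =>
      0 < theta < 1 /\ 0 < beta < 1 /\
      theta / 2 * ln ((1 + beta) / (1 - beta)) - beta = 0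
  | Polynomial => True
  end.

Definition beta (P : potential) : R :=
  match P with FloryHuggins _ b _ _ => b | Polynomial => 1 end.

Definition F (P : potential) (x : R) : R :=
  match P with
  | FloryHuggins theta b F_out _ =>
      if Rlt_dec (Rabs x) 1 then F_log theta x - F_log theta b else F_out x
  | Polynomial => F_pol x
  end.

Definition dF (P : potential) (x : R) : R :=
  match P with
  | FloryHuggins theta b _ dF_out =>
      if Rlt_dec (Rabs x) 1
      then Derive (fun y => F_log theta y - F_log theta b) x
      else dF_out x
  | Polynomial => Derive F_pol x
  end.

Definition c_F (P : potential) : R :=
  RInt (fun x => sqrt (2 * F P x)) (- beta P) (beta P).

Definition pos (x : R) : R := Rmax x 0.

(** The negative part is the nonpositive number [min(x, 0)]. *)
Definition neg (x : R) : R := Rmin x 0.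

Definition M (x1 x2 : R) : R := pos (1 + x1) * pos (1 - x2).

Record params : Type := Params {
  eps : R;
  kappa : R;
  dt : R;
  dx : R;
  dy : R;
  theta_s : R;
  Nx : nat;
  Ny : nat;
  Nt : nat;
  pot : potential
}.

Record params_wf (p : params) : Prop := {
  eps_pos : 0 < eps p;
  kappa_pos : 0 < kappa p;
  dt_pos : 0 < dt p;
  dx_pos : 0 < dx p;
  dy_pos : 0 < dy p;
  theta_s_range : 0 <= theta_s p <= PI;
  Nx_pos : (1 <= Nx p)%nat;
  Ny_pos : (1 <= Ny p)%nat;
  Nt_pos : (1 <= Nt p)%nat;
  pot_wf : potential_wf (pot p)
}.

Definition g (p : params) (x : R) : R :=
  eps p * c_F (pot p) * cos (theta_s p) / (4 * beta (pot p) ^ 3)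
  * (x ^ 3 - 3 * beta (pot p) ^ 2 * x).

Definition dg (p : params) (x : R) : R := Derive (g p) x.

(** Arguments are ordered [n i j], [n] being the time level.  Only the relevant
    index ranges are constrained.  Cells are [1 <= i <= Nx], [1 <= j <= Ny];
    the ghost values are [phi] at [i = 0], [i = Nx + 1], [j = 0], [j = Ny + 1].
    Faces are labelled by their lower neighbour: [Jx n i j], [Vx n i j] live at
    (i + 1/2, j), and [Jy n i j], [Vy n i j] live at (i, j + 1/2). *)
Record fields : Type := Fields {
  phi : nat -> nat -> nat -> R;
  mu : nat -> nat -> nat -> R;
  Jx : nat -> nat -> nat -> R;
  Jy : nat -> nat -> nat -> R;
  Vx : nat -> nat -> nat -> R;
  Vy : nat -> nat -> nat -> R;
  xi : nat -> R;
  eta : nat -> R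
}.

Definition laplacian (p : params) (s : fields) (n i j : nat) : R :=
  (phi s n (i + 1) j - 2 * phi s n i j + phi s n (i - 1) j) / dx p ^ 2
  + (phi s n i (j + 1) - 2 * phi s n i j + phi s n i (j - 1)) / dy p ^ 2.

(** [sum_n_m a 1 m] is the sum of [a i] over [1 <= i <= m]; it is 0 if [m = 0]. *)
Definition sum1 (m : nat) (a : nat -> R) : R := sum_n_m a 1 m.

Definition sum2 (m1 m2 : nat) (a : nat -> nat -> R) : R :=
  sum1 m1 (fun i => sum1 m2 (fun j => a i j)).

Record is_step (p : params) (s : fields) (n : nat) : Prop := {
  mass_balance : forall i j,
    (1 <= i <= Nx p)%nat -> (1 <= j <= Ny p)%nat ->
    phi s (n + 1) i j - phi s n i j =
      - (dt p / dx p) * (Jx s (n + 1) i j - Jx s (n + 1) (i - 1) j)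
      - dt p / dy p * (Jy s (n + 1) i j - Jy s (n + 1) i (j - 1));

  flux_x : forall i j,
    (1 <= i <= Nx p - 1)%nat -> (1 <= j <= Ny p)%nat ->
    Jx s (n + 1) i j =
      pos (Vx s (n + 1) i j) * M (phi s (n + 1) i j) (phi s (n + 1) (i + 1) j)
      + neg (Vx s (n + 1) i j) * M (phi s (n + 1) (i + 1) j) (phi s (n + 1) i j);

  velocity_x : forall i j,
    (1 <= i <= Nx p - 1)%nat -> (1 <= j <= Ny p)%nat ->
    Vx s (n + 1) i j = - (1 / dx p) * (mu s (n + 1) (i + 1) j - mu s (n + 1) i j);

  flux_y : forall i j,
    (1 <= i <= Nx p)%nat -> (1 <= j <= Ny p - 1)%nat ->
    Jy s (n + 1) i j =
      pos (Vy s (n + 1) i j) * M (phi s (n + 1) i j) (phi s (n + 1) i (j + 1))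
      + neg (Vy s (n + 1) i j) * M (phi s (n + 1) i (j + 1)) (phi s (n + 1) i j);

  velocity_y : forall i j,
    (1 <= i <= Nx p)%nat -> (1 <= j <= Ny p - 1)%nat ->
    Vy s (n + 1) i j = - (1 / dy p) * (mu s (n + 1) i (j + 1) - mu s (n + 1) i j);

  no_flux_x : forall j, (1 <= j <= Ny p)%nat ->
    Jx s (n + 1) 0 j = 0 /\ Jx s (n + 1) (Nx p) j = 0;

  no_flux_y : forall i, (1 <= i <= Nx p)%nat ->
    Jy s (n + 1) i 0 = 0 /\ Jy s (n + 1) i (Ny p) = 0;

  chemical_potential : forall i j,
    (1 <= i <= Nx p)%nat -> (1 <= j <= Ny p)%nat ->
    mu s (n + 1) i j =
      - eps p ^ 2 * laplacian p s (n + 1) i j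
      + xi s (n + 1) * dF (pot p) (phi s (n + 1) i j);

  ghost_x : forall j, (1 <= j <= Ny p)%nat ->
    phi s (n + 1) 0 j = phi s (n + 1) 1 j /\
    phi s (n + 1) (Nx p + 1) j = phi s (n + 1) (Nx p) j;

  ghost_top : forall i, (1 <= i <= Nx p)%nat ->
    phi s (n + 1) i (Ny p + 1) = phi s (n + 1) i (Ny p);

  ghost_substrate : forall i, (1 <= i <= Nx p)%nat ->
    phi s (n + 1) i 0 =
      (1 - dy p / (eps p ^ 2 * kappa p * dt p)) * phi s (n + 1) i 1
      + dy p / (eps p ^ 2 * kappa p * dt p) * phi s n i 1
      - dy p / eps p ^ 2 * eta s (n + 1) * dg p (phi s (n + 1) i 1);

  multiplier_bulk :
    sum2 (Nx p) (Ny p)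
      (fun i j => F (pot p) (phi s (n + 1) i j) - F (pot p) (phi s n i j)) =
    xi s (n + 1) *
    sum2 (Nx p) (Ny p)
      (fun i j => dF (pot p) (phi s (n + 1) i j)
                  * (phi s (n + 1) i j - phi s n i j));

  multiplier_wall :
    sum1 (Nx p) (fun i => g p (phi s (n + 1) i 1) - g p (phi s n i 1)) =
    eta s (n + 1) *
    sum1 (Nx p)
      (fun i => dg p (phi s (n + 1) i 1) * (phi s (n + 1) i 1 - phi s n i 1))
}.

Definition is_solution (p : params) (s : fields) : Prop :=
  forall n, (n < Nt p)%nat -> is_step p s n.

Definition energy (p : params) (s : fields) (n : nat) : R :=
  dx p * dy p * sum2 (Nx p - 1) (Ny p)
    (fun i j => eps p ^ 2 / 2 * ((phi s n (i + 1) j - phi s n i j) / dx p) ^ 2)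
  + dx p * dy p * sum2 (Nx p) (Ny p - 1)
    (fun i j => eps p ^ 2 / 2 * ((phi s n i (j + 1) - phi s n i j) / dy p) ^ 2)
  + dx p * dy p * sum2 (Nx p) (Ny p) (fun i j => F (pot p) (phi s n i j))
  + dx p * sum1 (Nx p) (fun i => g p (phi s n i 1)).

Definition energy_stable (p : params) (s : fields) : Prop :=
  forall n, (n < Nt p)%nat -> energy p s (n + 1) <= energy p s n.

Lemma dF_FloryHuggins theta b F_out dF_out x : Rabs x < 1 ->
  dF (FloryHuggins theta b F_out dF_out) x
  = theta / 2 * ln ((1 + x) / (1 - x)) - x.
Proof.
intros Hx; simpl; destruct (Rlt_dec (Rabs x) 1) as [_|]; [|lra].
apply Rabs_def2 in Hx.
apply is_derive_unique; unfold F_log; auto_derive; [lra|].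
change (1 + - x) with (1 - x); rewrite ln_div by lra; field; lra.
Qed.

Lemma dF_Polynomial x : dF Polynomial x = x ^ 3 - x.
Proof. apply is_derive_unique; unfold F_pol; auto_derive; [easy|field]. Qed.

Lemma dgE p x : beta (pot p) <> 0 ->
  dg p x = 3 * eps p * c_F (pot p) * cos (theta_s p) / (4 * beta (pot p) ^ 3)
           * (x ^ 2 - beta (pot p) ^ 2).
Proof.
intros Hb; apply is_derive_unique; unfold g; auto_derive; [easy|now field].
Qed.

Lemma c_F_ex_RInt P : potential_wf P ->
  ex_RInt (fun x => sqrt (2 * F P x)) (- beta P) (beta P).
Proof.
destruct P as [theta b F_out dF_out|]; simpl; intros HP.
- apply ex_RInt_ext with (fun x => sqrt (2 * (F_log theta x - F_log theta b))).
  + intros x; rewrite Rmin_left, Rmax_right by lra; intros Hx.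
    destruct (Rlt_dec (Rabs x) 1) as [_|H]; [easy|].
    destruct H; apply Rabs_def1; lra.
  + apply (ex_RInt_continuous (V := R_CompleteNormedModule)); intros x.
    rewrite Rmin_left, Rmax_right by lra; intros Hx.
    apply (continuous_comp (fun x => 2 * (F_log theta x - F_log theta b)) sqrt).
    * apply (ex_derive_continuous (V := R_NormedModule)); unfold F_log; auto_derive; lra.
    * apply continuous_sqrt.
- apply (ex_RInt_continuous (V := R_CompleteNormedModule)); intros x _.
  apply (continuous_comp (fun x => 2 * F_pol x) sqrt).
  + apply (ex_derive_continuous (V := R_NormedModule)); unfold F_pol; auto_derive; easy.
  + apply continuous_sqrt.
Qed.

(* Main.v *)
Require Import Defs.
From Stdlib Require Import Reals Lra Lia.
From Coquelicot Require Import Coquelicot.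
Open Scope R_scope.

(** The scheme is built so that testing the equations with the increment
    [d = phi^{n+1} - phi^n] reproduces the energy balance of the continuous
    gradient flow.

    - Gradient part.  Since [x^2] is convex, [a^2 - b^2 <= 2 a (a - b)], so the
      growth of the gradient energy is at most the Dirichlet form of [phi^{n+1}]
      against [d].  Summation by parts turns this into [- eps^2 Lap phi^{n+1}]
      tested with [d], plus boundary terms ([gradient_energy_increment]).  The
      Neumann ghost values cancel every boundary term except the one on the
      substrate.
    - Potentials.  The multiplier equations say precisely that the increments of
      the bulk and of the wall energy equal [xi F'] and [eta g'] tested with [d];
      this replaces the convexity that [F] and [g] lack in general.
    - Substrate.  The ghost value there makes the remaining boundary term equal
      to [- eta g'] tested with [d], which cancels the wall energy, up to the
      relaxation term [- d^2 / (kappa dt) <= 0] ([wall_relaxation]).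

    What is left is that the energy grows by at most [mu^{n+1}] tested with [d]
    ([energy_increment_le_work]).  By mass balance and a second summation by
    parts, with no boundary term because of the no-flux condition, this work
    equals [- dt] times the sum of [J V] over the interior faces
    ([work_by_fluxes]).  Upwinding gives [J V >= min (M, M') V^2] on each face,
    whatever the sign of [V] ([upwind_dissipation]), and the mobilities are
    nonnegative as products of positive parts. *)

(** * Finite sums *)

Lemma sum1_0 a : sum1 0 a = 0.
Proof. unfold sum1; rewrite sum_n_m_zero; [easy|lia]. Qed.

Lemma sum1_S m a : sum1 (S m) a = sum1 m a + a (S m).
Proof. unfold sum1; rewrite sum_n_Sm; [easy|lia]. Qed.

Lemma sum1_ext m a b :
  (forall i, (1 <= i <= m)%nat -> a i = b i) -> sum1 m a = sum1 m b.
Proof. intros H; apply sum_n_m_ext_loc; exact H. Qed.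

Lemma sum1_le m a b :
  (forall i, (1 <= i <= m)%nat -> a i <= b i) -> sum1 m a <= sum1 m b.
Proof.
induction m as [|m IH]; intros H; [rewrite !sum1_0; lra|].
rewrite !sum1_S; apply Rplus_le_compat; [apply IH; intros i Hi|]; apply H; lia.
Qed.

(** The only linearity rule for sums: differences and multiples are brought to
    this shape by coefficients [1], [-1], or a zero second summand. *)
Lemma sum1_lin m c1 c2 a b :
  sum1 m (fun i => c1 * a i + c2 * b i) = c1 * sum1 m a + c2 * sum1 m b.
Proof.
induction m as [|m IH]; [rewrite !sum1_0; ring|].
rewrite !sum1_S, IH; ring.
Qed.

Lemma sum1_const0 m : sum1 m (fun _ => 0) = 0.
Proof.
induction m as [|m IH]; [apply sum1_0|rewrite sum1_S, IH; ring].
Qed.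

Lemma sum2_ext m1 m2 a b :
  (forall i j, (1 <= i <= m1)%nat -> (1 <= j <= m2)%nat -> a i j = b i j) ->
  sum2 m1 m2 a = sum2 m1 m2 b.
Proof.
intros H; apply sum1_ext; intros i Hi; apply sum1_ext; intros j Hj; now apply H.
Qed.

Lemma sum2_le m1 m2 a b :
  (forall i j, (1 <= i <= m1)%nat -> (1 <= j <= m2)%nat -> a i j <= b i j) ->
  sum2 m1 m2 a <= sum2 m1 m2 b.
Proof.
intros H; apply sum1_le; intros i Hi; apply sum1_le; intros j Hj; now apply H.
Qed.

Lemma sum2_nonneg m1 m2 a :
  (forall i j, (1 <= i <= m1)%nat -> (1 <= j <= m2)%nat -> 0 <= a i j) ->
  0 <= sum2 m1 m2 a.
Proof.
intros H; replace 0 with (sum2 m1 m2 (fun _ _ => 0)) at 1.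
- now apply sum2_le.
- unfold sum2; now rewrite !sum1_const0.
Qed.

Lemma sum2_lin m1 m2 c1 c2 a b :
  sum2 m1 m2 (fun i j => c1 * a i j + c2 * b i j)
  = c1 * sum2 m1 m2 a + c2 * sum2 m1 m2 b.
Proof.
unfold sum2; rewrite <- sum1_lin; apply sum1_ext; intros i _; apply sum1_lin.
Qed.

Lemma sum2_swap m1 m2 a : sum2 m1 m2 a = sum2 m2 m1 (fun j i => a i j).
Proof.
unfold sum2; induction m1 as [|m1 IH].
- rewrite sum1_0, <- (sum1_const0 m2); apply sum1_ext; intros j _.
  now rewrite sum1_0.
- rewrite sum1_S, IH.
  transitivity (1 * sum1 m2 (fun j => sum1 m1 (fun i => a i j))
                + 1 * sum1 m2 (fun j => a (S m1) j)); [ring|].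
  rewrite <- sum1_lin; apply sum1_ext; intros j _; rewrite sum1_S; ring.
Qed.

(** [G i] lives on the face between cells [i] and [i + 1], so the two boundary
    faces are [0] and [m]. *)
Lemma summation_by_parts m (G a : nat -> R) : (1 <= m)%nat ->
  sum1 m (fun i => (G i - G (i - 1)%nat) * a i)
  = G m * a m - G 0%nat * a 1%nat
    - sum1 (m - 1) (fun i => G i * (a (i + 1)%nat - a i)).
Proof.
intros Hm; destruct m as [|m]; [lia|clear Hm].
replace (S m - 1)%nat with m by lia.
induction m as [|m IH]; [rewrite sum1_S, !sum1_0; simpl; ring|].
rewrite (sum1_S (S m)), IH, (sum1_S m (fun i => G i * _)).
replace (S (S m) - 1)%nat with (S m) by lia.
replace (S m + 1)%nat with (S (S m)) by lia; ring.
Qed.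

(** * Energy growth along one grid line *)

(** Convexity of the square, then summation by parts, which produces minus the
    Laplacian of the new state tested with the increment and two boundary terms,
    whose one-sided differences involve the ghost values [u 0] and
    [u (m + 1)]. *)
Lemma gradient_energy_increment m c h (u v : nat -> R) :
  (1 <= m)%nat -> 0 <= c -> 0 < h ->
  sum1 (m - 1) (fun i => c / 2 * ((u (i + 1)%nat - u i) / h) ^ 2)
  - sum1 (m - 1) (fun i => c / 2 * ((v (i + 1)%nat - v i) / h) ^ 2)
  <= c / h ^ 2 * ((u (m + 1)%nat - u m) * (u m - v m)
                  - (u 1%nat - u 0%nat) * (u 1%nat - v 1%nat))
     - c * sum1 m (fun i => (u (i + 1)%nat - 2 * u i + u (i - 1)%nat) / h ^ 2
                            * (u i - v i)).
Proof.
intros Hm Hc Hh.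
pose proof (summation_by_parts m (fun i => u (i + 1)%nat - u i)
              (fun i => u i - v i) Hm) as SBP; cbv beta in SBP.
change (0 + 1)%nat with 1%nat in SBP.
assert (Lap : sum1 m (fun i => (u (i + 1)%nat - 2 * u i + u (i - 1)%nat) / h ^ 2
                               * (u i - v i))
  = / h ^ 2 * sum1 m (fun i => (u (i + 1)%nat - u i
                                 - (u (i - 1 + 1)%nat - u (i - 1)%nat))
                               * (u i - v i)) + 0 * sum1 m (fun _ => 0)).
{ rewrite <- sum1_lin; apply sum1_ext; intros i Hi.
  replace (i - 1 + 1)%nat with i by lia; unfold Rdiv; ring. }
rewrite Lap, SBP.
enough (Conv :
  1 * sum1 (m - 1) (fun i => c / 2 * ((u (i + 1)%nat - u i) / h) ^ 2)
  + -1 * sum1 (m - 1) (fun i => c / 2 * ((v (i + 1)%nat - v i) / h) ^ 2)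
  <= c / h ^ 2 * sum1 (m - 1) (fun i => (u (i + 1)%nat - u i)
                     * (u (i + 1)%nat - v (i + 1)%nat - (u i - v i)))
     + 0 * sum1 (m - 1) (fun _ => 0)).
{ unfold Rdiv in *; nra. }
rewrite <- !sum1_lin; apply sum1_le; intros i _.
set (a := u (i + 1)%nat - u i); set (b := v (i + 1)%nat - v i).
replace (u (i + 1)%nat - v (i + 1)%nat - (u i - v i)) with (a - b)
  by (unfold a, b; ring).
assert (0 <= c / 2 * ((a - b) / h) ^ 2)
  by (apply Rmult_le_pos; [lra|apply pow2_ge_0]).
enough (c / h ^ 2 * (a * (a - b)) + 0 * 0
        - (1 * (c / 2 * (a / h) ^ 2) + -1 * (c / 2 * (b / h) ^ 2))
        = c / 2 * ((a - b) / h) ^ 2) by lra.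
field; lra.
Qed.

(** * Upwind fluxes *)

Lemma M_nonneg x y : 0 <= M x y.
Proof. apply Rmult_le_pos; apply Rmax_r. Qed.

Lemma Rmin_M_nonneg x y : 0 <= Rmin (M x y) (M y x).
Proof. apply Rmin_glb; apply M_nonneg. Qed.

(** Only one of the two upwind states contributes, namely the one selected by
    the sign of [V], and its mobility is at least the minimum of the two. *)
Lemma upwind_dissipation V A B :
  Rmin A B * Rabs V ^ 2 <= (Defs.pos V * A + Defs.neg V * B) * V.
Proof.
rewrite pow2_abs.
pose proof (Rmin_l A B); pose proof (Rmin_r A B); pose proof (pow2_ge_0 V).
unfold Defs.pos, Defs.neg; destruct (Rle_dec 0 V).
- rewrite Rmax_left, (Rmin_right V) by lra; apply Rle_trans with (A * V ^ 2);
    [now apply Rmult_le_compat_r|lra].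
- rewrite Rmax_right, (Rmin_left V) by lra; apply Rle_trans with (B * V ^ 2);
    [now apply Rmult_le_compat_r|lra].
Qed.

(** * One time step *)

Section Step.

Variables (p : params) (s : fields) (n : nat).
Hypotheses (Hp : params_wf p) (Hs : is_step p s n).

Let u := phi s (n + 1).
Let v := phi s n.
Let d i j := u i j - v i j.

Let Lx i j := (u (i + 1)%nat j - 2 * u i j + u (i - 1)%nat j) / dx p ^ 2.
Let Ly i j := (u i (j + 1)%nat - 2 * u i j + u i (j - 1)%nat) / dy p ^ 2.

Lemma gradient_energy_x :
  sum2 (Nx p - 1) (Ny p)
    (fun i j => eps p ^ 2 / 2 * ((u (i + 1)%nat j - u i j) / dx p) ^ 2)
  - sum2 (Nx p - 1) (Ny p)
    (fun i j => eps p ^ 2 / 2 * ((v (i + 1)%nat j - v i j) / dx p) ^ 2)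
  <= - eps p ^ 2 * sum2 (Nx p) (Ny p) (fun i j => Lx i j * d i j).
Proof.
rewrite (sum2_swap _ _ (fun i j => _ * ((u _ _ - _) / _) ^ 2)).
rewrite (sum2_swap _ _ (fun i j => _ * ((v _ _ - _) / _) ^ 2)).
rewrite (sum2_swap (Nx p) (Ny p)).
unfold sum2.
match goal with |- ?A - ?B <= ?c * ?C =>
  enough (1 * A + -1 * B <= c * C + 0 * sum1 (Ny p) (fun _ => 0)) by lra end.
rewrite <- !sum1_lin; apply sum1_le; intros j Hj.
pose proof (gradient_energy_increment (Nx p) (eps p ^ 2) (dx p)
  (fun i => u i j) (fun i => v i j) (Nx_pos _ Hp) (pow2_ge_0 _) (dx_pos _ Hp)) as H.
cbv beta in H.
destruct (ghost_x _ _ _ Hs j Hj) as [H0 H1].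
fold u in H0, H1; rewrite H0, H1 in H.
unfold Lx, d; lra.
Qed.

Lemma gradient_energy_y :
  sum2 (Nx p) (Ny p - 1)
    (fun i j => eps p ^ 2 / 2 * ((u i (j + 1)%nat - u i j) / dy p) ^ 2)
  - sum2 (Nx p) (Ny p - 1)
    (fun i j => eps p ^ 2 / 2 * ((v i (j + 1)%nat - v i j) / dy p) ^ 2)
  <= - eps p ^ 2 * sum2 (Nx p) (Ny p) (fun i j => Ly i j * d i j)
     - eps p ^ 2 / dy p ^ 2
       * sum1 (Nx p) (fun i => (u i 1%nat - u i 0%nat) * d i 1%nat).
Proof.
unfold sum2.
match goal with |- ?A - ?B <= ?c * ?C - ?e * ?D =>
  enough (1 * A + -1 * B <= c * C + (- e) * D) by lra end.
rewrite <- !sum1_lin; apply sum1_le; intros i Hi.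
pose proof (gradient_energy_increment (Ny p) (eps p ^ 2) (dy p)
  (fun j => u i j) (fun j => v i j) (Ny_pos _ Hp) (pow2_ge_0 _) (dy_pos _ Hp)) as H.
cbv beta in H.
pose proof (ghost_top _ _ _ Hs i Hi) as H1.
fold u in H1; rewrite H1 in H.
unfold Ly, d; lra.
Qed.

(** The substrate ghost value is the contact line condition solved for
    [u i 0]: the scaled normal difference [eps^2 (u_1 - u_0) / dy] at the wall
    is the relaxation rate [d / (kappa dt)] plus the wall force [eta g']. *)
Lemma wall_relaxation :
  sum1 (Nx p) (fun i => g p (u i 1%nat) - g p (v i 1%nat))
  <= eps p ^ 2 / dy p
     * sum1 (Nx p) (fun i => (u i 1%nat - u i 0%nat) * d i 1%nat).
Proof.
pose proof (eps_pos _ Hp); pose proof (kappa_pos _ Hp);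
pose proof (dt_pos _ Hp); pose proof (dy_pos _ Hp).
pose proof (multiplier_wall _ _ _ Hs) as HW; fold u v in HW; rewrite HW.
match goal with |- ?e * ?A <= ?f * ?B =>
  enough (e * A + 0 * sum1 (Nx p) (fun _ => 0)
          <= f * B + 0 * sum1 (Nx p) (fun _ => 0)) by lra end.
rewrite <- !sum1_lin; apply sum1_le; intros i Hi.
pose proof (ghost_substrate _ _ _ Hs i Hi) as HG; fold u v in HG; rewrite HG.
assert (0 <= / (kappa p * dt p) * d i 1%nat ^ 2).
{ apply Rmult_le_pos; [|apply pow2_ge_0].
  apply Rlt_le, Rinv_0_lt_compat, Rmult_lt_0_compat; lra. }
match goal with |- ?A <= ?B =>
  enough (B - A = / (kappa p * dt p) * d i 1%nat ^ 2) by lra end.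
unfold d; field; lra.
Qed.

(** The substrate boundary term of the gradient energy and the wall energy
    cancel here; everything else is collected in [mu]. *)
Lemma energy_increment_le_work :
  energy p s (n + 1) - energy p s n
  <= dx p * dy p * sum2 (Nx p) (Ny p) (fun i j => mu s (n + 1) i j * d i j).
Proof.
pose proof (dx_pos _ Hp) as Hdx; pose proof (dy_pos _ Hp) as Hdy.
assert (Work : sum2 (Nx p) (Ny p) (fun i j => mu s (n + 1) i j * d i j)
  = 1 * (- eps p ^ 2 * sum2 (Nx p) (Ny p) (fun i j => Lx i j * d i j)
         + - eps p ^ 2 * sum2 (Nx p) (Ny p) (fun i j => Ly i j * d i j))
    + xi s (n + 1)
      * sum2 (Nx p) (Ny p) (fun i j => dF (pot p) (u i j) * d i j)).
{ rewrite <- !sum2_lin; apply sum2_ext; intros i j Hi Hj.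
  rewrite (chemical_potential _ _ _ Hs i j Hi Hj).
  unfold laplacian; fold u; unfold Lx, Ly; ring. }
pose proof (multiplier_bulk _ _ _ Hs) as HB; fold u v in HB; fold d in HB.
assert (BulkSplit : forall a b : nat -> nat -> R,
  sum2 (Nx p) (Ny p) (fun i j => a i j - b i j)
  = sum2 (Nx p) (Ny p) a - sum2 (Nx p) (Ny p) b).
{ intros a b; transitivity (1 * sum2 (Nx p) (Ny p) a + -1 * sum2 (Nx p) (Ny p) b);
    [rewrite <- sum2_lin; apply sum2_ext; intros; ring|ring]. }
rewrite (BulkSplit (fun i j => F (pot p) (u i j))) in HB.
pose proof wall_relaxation as HW.
assert (WallSplit : sum1 (Nx p) (fun i => g p (u i 1%nat) - g p (v i 1%nat))
  = 1 * sum1 (Nx p) (fun i => g p (u i 1%nat))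
    + -1 * sum1 (Nx p) (fun i => g p (v i 1%nat))).
{ rewrite <- sum1_lin; apply sum1_ext; intros; ring. }
rewrite WallSplit in HW.
pose proof gradient_energy_x as HX; pose proof gradient_energy_y as HY.
unfold energy; fold u v.
rewrite Work.
change (fun i j => dF (pot p) (u i j) * d i j)
  with (fun i j => dF (pot p) (u i j) * (u i j - v i j)).
rewrite <- HB.
apply (Rmult_le_compat_l (dx p * dy p)) in HX; [|nra].
apply (Rmult_le_compat_l (dx p * dy p)) in HY; [|nra].
apply (Rmult_le_compat_l (dx p)) in HW; [|lra].
match type of HW with _ <= ?a * (?e / ?h * ?W) =>
  replace (a * (e / h * W)) with (a * h * (e / h ^ 2 * W)) in HW
    by (field; lra) end.
lra.
Qed.

(** The no-flux condition removes the boundary terms of the summation by parts,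
    and the difference of [mu] across a face is [- h V]. *)
Lemma work_by_fluxes :
  sum2 (Nx p) (Ny p) (fun i j => mu s (n + 1) i j * d i j)
  = - dt p * sum2 (Nx p - 1) (Ny p) (fun i j => Jx s (n + 1) i j * Vx s (n + 1) i j)
    + - dt p
      * sum2 (Nx p) (Ny p - 1) (fun i j => Jy s (n + 1) i j * Vy s (n + 1) i j).
Proof.
pose proof (dx_pos _ Hp) as Hdx; pose proof (dy_pos _ Hp) as Hdy.
set (m := mu s (n + 1)).
transitivity (
  - (dt p / dx p) * sum2 (Nx p) (Ny p) (fun i j =>
      (Jx s (n + 1) i j - Jx s (n + 1) (i - 1) j) * m i j)
  + - (dt p / dy p) * sum2 (Nx p) (Ny p) (fun i j =>
      (Jy s (n + 1) i j - Jy s (n + 1) i (j - 1)) * m i j)).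
{ rewrite <- sum2_lin; apply sum2_ext; intros i j Hi Hj.
  pose proof (mass_balance _ _ _ Hs i j Hi Hj) as H; fold u v in H.
  unfold d; rewrite H; ring. }
f_equal.
- rewrite (sum2_swap (Nx p) (Ny p)), (sum2_swap (Nx p - 1)); unfold sum2.
  match goal with |- ?a * ?A = ?b * ?B =>
    enough (a * A + 0 * sum1 (Ny p) (fun _ => 0)
            = b * B + 0 * sum1 (Ny p) (fun _ => 0)) by lra end.
  rewrite <- !sum1_lin; apply sum1_ext; intros j Hj.
  rewrite (summation_by_parts (Nx p) (fun i => Jx s (n + 1) i j) (fun i => m i j))
    by apply (Nx_pos _ Hp).
  destruct (no_flux_x _ _ _ Hs j Hj) as [-> ->].
  assert (Face : sum1 (Nx p - 1) (fun i => Jx s (n + 1) i j * (m (i + 1)%nat j - m i j))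
    = - dx p * sum1 (Nx p - 1) (fun i => Jx s (n + 1) i j * Vx s (n + 1) i j)
      + 0 * sum1 (Nx p - 1) (fun _ => 0)).
  { rewrite <- sum1_lin; apply sum1_ext; intros i Hi.
    rewrite (velocity_x _ _ _ Hs i j Hi Hj); fold m; field; lra. }
  rewrite Face; field; lra.
- unfold sum2.
  match goal with |- ?a * ?A = ?b * ?B =>
    enough (a * A + 0 * sum1 (Nx p) (fun _ => 0)
            = b * B + 0 * sum1 (Nx p) (fun _ => 0)) by lra end.
  rewrite <- !sum1_lin; apply sum1_ext; intros i Hi.
  rewrite (summation_by_parts (Ny p) (fun j => Jy s (n + 1) i j) (fun j => m i j))
    by apply (Ny_pos _ Hp).
  destruct (no_flux_y _ _ _ Hs i Hi) as [-> ->].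
  assert (Face : sum1 (Ny p - 1) (fun j => Jy s (n + 1) i j * (m i (j + 1)%nat - m i j))
    = - dy p * sum1 (Ny p - 1) (fun j => Jy s (n + 1) i j * Vy s (n + 1) i j)
      + 0 * sum1 (Ny p - 1) (fun _ => 0)).
  { rewrite <- sum1_lin; apply sum1_ext; intros j Hj.
    rewrite (velocity_y _ _ _ Hs i j Hi Hj); fold m; field; lra. }
  rewrite Face; field; lra.
Qed.

Lemma dissipation_law :
  (energy p s (n + 1) - energy p s n) / dt p <=
    - dx p * dy p * sum2 (Nx p - 1) (Ny p) (fun i j =>
        Rmin (M (u i j) (u (i + 1)%nat j)) (M (u (i + 1)%nat j) (u i j))
        * Rabs (Vx s (n + 1) i j) ^ 2)
    - dx p * dy p * sum2 (Nx p) (Ny p - 1) (fun i j =>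
        Rmin (M (u i j) (u i (j + 1)%nat)) (M (u i (j + 1)%nat) (u i j))
        * Rabs (Vy s (n + 1) i j) ^ 2)
    <= 0.
Proof.
pose proof (dx_pos _ Hp) as Hdx; pose proof (dy_pos _ Hp) as Hdy;
pose proof (dt_pos _ Hp) as Hdt.
assert (Hxy : 0 <= dx p * dy p) by nra.
split.
- apply Rle_div_l; [lra|].
  eapply Rle_trans; [apply energy_increment_le_work|].
  rewrite work_by_fluxes.
  match goal with |- _ <= (- _ * _ * ?X - _ * ?Y) * _ =>
    assert (HX : X <= sum2 (Nx p - 1) (Ny p)
                        (fun i j => Jx s (n + 1) i j * Vx s (n + 1) i j));
    [|assert (HY : Y <= sum2 (Nx p) (Ny p - 1)
                        (fun i j => Jy s (n + 1) i j * Vy s (n + 1) i j))]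
  end.
  + apply sum2_le; intros i j Hi Hj.
    rewrite (flux_x _ _ _ Hs i j Hi Hj); apply upwind_dissipation.
  + apply sum2_le; intros i j Hi Hj.
    rewrite (flux_y _ _ _ Hs i j Hi Hj); apply upwind_dissipation.
  + apply (Rmult_le_compat_l (dx p * dy p * dt p)) in HX; [|nra].
    apply (Rmult_le_compat_l (dx p * dy p * dt p)) in HY; [|nra].
    lra.
- match goal with |- - _ * _ * ?X - _ * ?Y <= 0 =>
    assert (HX : 0 <= X); [|assert (HY : 0 <= Y)] end.
  + apply sum2_nonneg; intros i j _ _.
    apply Rmult_le_pos; [apply Rmin_M_nonneg|apply pow2_ge_0].
  + apply sum2_nonneg; intros i j _ _.
    apply Rmult_le_pos; [apply Rmin_M_nonneg|apply pow2_ge_0].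
  + apply (Rmult_le_compat_l (dx p * dy p)) in HX; [|lra].
    apply (Rmult_le_compat_l (dx p * dy p)) in HY; [|lra].
    lra.
Qed.

End Step.

Theorem theorem3 (p : params) (s : fields)
  (Hp : params_wf p) (Hs : is_solution p s) :
  energy_stable p s /\
  forall n : nat, (n < Nt p)%nat ->
    (energy p s (n + 1) - energy p s n) / dt p <=
      - dx p * dy p * sum2 (Nx p - 1) (Ny p) (fun i j =>
          Rmin (M (phi s (n + 1) i j) (phi s (n + 1) (i + 1) j))
               (M (phi s (n + 1) (i + 1) j) (phi s (n + 1) i j))
          * Rabs (Vx s (n + 1) i j) ^ 2)
      - dx p * dy p * sum2 (Nx p) (Ny p - 1) (fun i j =>
          Rmin (M (phi s (n + 1) i j) (phi s (n + 1) i (j + 1)))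
               (M (phi s (n + 1) i (j + 1)) (phi s (n + 1) i j))
          * Rabs (Vy s (n + 1) i j) ^ 2)
      <= 0.
Proof.
split; intros n Hn; pose proof (dissipation_law p s n Hp (Hs n Hn)) as H.
- pose proof (Rle_trans _ _ _ (proj1 H) (proj2 H)) as H0.
  apply Rle_div_l in H0; [lra|apply (dt_pos _ Hp)].
- exact H.
Qed.
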